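(* For each fixed $p\in(0,1)$, there is a constant $c>0$ such that for $G$ sampled from $\mathbb{G}(n,p)$, with high probability $$c\,\chi(G)\le\frac{\mathring{s}(G)}{n}\le\chi(G).$$
   Context: All graphs are finite and simple. The slow-coloring game on a graph $G$ is played by Lister and Painter. On each round, Lister marks a nonempty subset $M$ of the uncolored vertices, scoring $|M|$ points; Painter then colors (with a new color) a subset of $M$ that is independent in $G$. The game ends when all vertices are colored. Painter wants to minimize the total score and Lister wants to maximize it. The sum-color cost $\mathring{s}(G)$ is the total score under optimal play by both players (the score that each player can guarantee doing no worse than). $\chi(G)$ is the chromatic number. $\mathbb{G}(n,p)$ is the binomial random graph model: the probability space of graphs with vertex set $\{1,\dots,n\}$ in which each pair of vertices is an edge with probability $p$, independently. An event occurs with high probability if its probability in $\mathbb{G}(n,p)$ tends to $1$ as $n\to\infty$. *)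

(* Defs.v *)
From HB Require Import structures.
From mathcomp Require Import all_boot all_order all_algebra.
From mathcomp Require Import all_classical all_reals all_analysis.
From mathcomp Require Import zify.

Set Implicit Arguments.
Unset Strict Implicit.
Unset Printing Implicit Defensive.

Import Order.TTheory GRing.Theory Num.Theory.
Import numFieldNormedType.Exports.

Local Open Scope nat_scope.

Record sgraph (T : finType) := SGraph {
  edges : {set {set T}};
  edges_card2 : [forall e in edges, #|e| == 2]
}.

HB.instance Definition _ (T : finType) := [isSub for @edges T].
HB.instance Definition _ (T : finType) := [Finite of sgraph T by <:].

Section Graphs.
Variables (T : finType) (G : sgraph T).
Implicit Types (x y : T) (I M U : {set T}) (k : nat).

Definition adj x y : bool := [set x; y]%SET \in edges G.

Lemma adj_sym x y : adj x y = adj y x.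
Proof. by rewrite /adj finset.setUC. Qed.

Lemma adj_irrefl x : adj x x = false.
Proof.
apply/negP => xx; have /forall_inP/(_ _ xx) := edges_card2 G.
by rewrite finset.setUid cards1.
Qed.

Definition independent I : bool := [forall x in I, forall y in I, ~~ adj x y].

Definition colorable k : bool :=
  [exists f : {ffun T -> 'I_k}, forall x, forall y, adj x y ==> (f x != f y)].

Lemma colorable_card : colorable #|T|.
Proof.
apply/existsP; exists [ffun x => enum_rank x].
apply/forallP => x; apply/forallP => y; apply/implyP; rewrite !ffunE.
by apply: contraTneq => /enum_rank_inj ->; rewrite adj_irrefl.
Qed.

Definition chromatic_number : nat := ex_minn (ex_intro colorable _ colorable_card).

(* From the position with uncolored set U, Painter can force the game to end
   with at most k further points.  Painter may answer with the empty set; as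
   every round costs at least one point, a play that never ends is excluded. *)
Inductive painter_guarantees : {set T} -> nat -> Prop :=
| PainterGuarantees U k of
    (forall M, M \subset U -> M != finset.set0 ->
       exists I, [/\ I \subset M, independent I, #|M| <= k &
                     painter_guarantees (U :\: I) (k - #|M|)]) :
    painter_guarantees U k.

(* From the position with uncolored set U, Lister can score at least k further
   points.  The truncated subtraction means that nothing remains to be scored
   once k points have been reached. *)
Inductive lister_guarantees : {set T} -> nat -> Prop :=
| ListerReached U : lister_guarantees U 0
| ListerMarks U k M of M \subset U & M != finset.set0 &
    (forall I, I \subset M -> independent I ->
       lister_guarantees (U :\: I) (k - #|M|)) :
    lister_guarantees U k.

Lemma guarantees_le U k j :
  lister_guarantees U k -> painter_guarantees U j -> k <= j.
Proof.
move=> lis; elim: lis j => // {}U {}k M MU M0 _ IH j pai.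
case: pai MU => {}U {}j pai MU in IH *.
have [I [IM indI Mj /(IH _ IM indI)]] := pai M MU M0.
lia.
Qed.

Lemma guarantees_determined k U :
  painter_guarantees U k \/ lister_guarantees U k.+1.
Proof.
elim/ltn_ind: k U => k IH U.
have [?|lis] := pselect (lister_guarantees U k.+1); [by right | left].
constructor => M MU M0; apply: contrapT => noI.
apply: lis; apply: (ListerMarks MU M0) => I IM indI.
have M_gt0 : 0 < #|M| by rewrite card_gt0.
have [Mk|kM] := leqP #|M| k; last first.
  have -> : k.+1 - #|M| = 0 by lia.
  exact: ListerReached.
rewrite subSn //.
have [|pai|//] := IH (k - #|M|) _ (U :\: I); first by lia.
by case: noI; exists I.
Qed.

Lemma lister_bounded U k : lister_guarantees U k -> k <= #|U| * #|U|.
Proof.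
elim=> // {}U {}k M MU /set0Pn[x xM] _ IH.
have indx : independent [set x]%SET.
  by apply/forall_inP => y /set1P ->; apply/forall_inP => z /set1P ->;
     rewrite adj_irrefl.
have := IH _ _ indx; rewrite finset.sub1set => /(_ xM).
have := cardsD1 x U; rewrite (fintype.subsetP MU x xM).
have := subset_leq_card MU.
nia.
Qed.

Lemma sum_color_cost_exists :
  exists s, painter_guarantees [set: T]%SET s /\ lister_guarantees [set: T]%SET s.
Proof.
pose P k := `[< painter_guarantees [set: T]%SET k >].
have exP : exists k, P k.
  exists (#|[set: T]%SET| * #|[set: T]%SET|); apply/asboolP.
  have [//|/lister_bounded] := guarantees_determined
    (#|[set: T]%SET| * #|[set: T]%SET|) [set: T]%SET.
  by rewrite ltnn.
case: (ex_minnP exP) => -[|s] /asboolP pai smin; [exists 0|exists s.+1]; split => //.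
  exact: ListerReached.
have [/asboolP/smin|//] := guarantees_determined s [set: T]%SET.
by rewrite ltnn.
Qed.

(* The common score that both players can guarantee from the start. *)
Definition sum_color_cost : nat := sval (cid sum_color_cost_exists).

Lemma sum_color_costP :
  painter_guarantees [set: T]%SET sum_color_cost /\
  lister_guarantees [set: T]%SET sum_color_cost.
Proof. exact: svalP (cid sum_color_cost_exists). Qed.

Lemma sum_color_cost_unique s :
  painter_guarantees [set: T]%SET s -> lister_guarantees [set: T]%SET s ->
  s = sum_color_cost.
Proof.
have [pai lis] := sum_color_costP => pai' lis'.
by apply/eqP; rewrite eqn_leq (guarantees_le lis' pai) (guarantees_le lis pai').
Qed.

End Graphs.

Local Open Scope ring_scope.
Local Open Scope classical_set_scope.

Section RandomGraph.
Variable R : realType.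
Implicit Type p : R.

Definition gnp_weight p n (G : sgraph 'I_n) : R :=
  \prod_(e : {set 'I_n} | #|e| == 2%N) (if e \in edges G then p else 1 - p).

Definition gnp_prob p n (A : pred (sgraph 'I_n)) : R :=
  \sum_(G | A G) gnp_weight p G.

(* Each pair is an edge with probability p, mutually independently. *)
Lemma gnp_prob_edges p n (H : sgraph 'I_n) :
  gnp_prob p (fun G => edges H \subset edges G) = p ^+ #|edges H|.
Proof.
pose F (e : {set 'I_n}) := if #|e| == 2%N then p else 0.
pose C (e : {set 'I_n}) :=
  if e \in edges H then 0 else if #|e| == 2%N then 1 - p else 1.
have H2 e : e \in edges H -> #|e| == 2%N.
  by have /forall_inP := edges_card2 H; apply.
have -> : p ^+ #|edges H| = \prod_e (F e + C e).
  rewrite -prodr_const big_mkcond; apply: eq_bigr => e _; rewrite /F /C.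
  case: ifP => [/H2 ->|_]; first by rewrite addr0.
  by case: ifP => _; rewrite ?add0r // addrC subrK.
rewrite bigA_distr.
rewrite (bigID (fun E : {set {set 'I_n}} =>
  [forall e in E, #|e| == 2%N] && (edges H \subset E))) /=.
rewrite [X in _ = _ + X]big1 ?addr0; last first.
  move=> E; rewrite negb_and => /orP[/forall_inPn[e eE e2]|/subsetPn[e eH eE]].
    by rewrite (bigD1 e) //= eE /F (negbTE e2) mul0r.
  by rewrite (bigD1 e) //= (negbTE eE) /C eH mul0r.
rewrite (reindex_omap (@edges 'I_n) insub) => [|E /andP[E2 _]]; last first.
  by rewrite insubT.
apply: eq_big => [G|G HG].
  by rewrite edges_card2 (valK G) eqxx andbT.
rewrite /gnp_weight big_mkcond; apply: eq_bigr => e _; rewrite /F /C.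
case: ifPn => [e2|e2].
  case: ifPn => // eG; case: ifPn => // /(fintype.subsetP HG).
  by rewrite (negbTE eG).
have /forall_inP G2 := edges_card2 G.
rewrite ifF; last by apply: contraNF e2 => /G2.
by rewrite ifF //; apply: contraNF e2 => /H2.
Qed.

Lemma gnp_prob_total p n : gnp_prob p (@predT (sgraph 'I_n)) = 1.
Proof.
have E0 : [forall e in finset.set0 : {set {set 'I_n}}, #|e| == 2%N].
  by apply/forall_inP => e; rewrite finset.in_set0.
have := gnp_prob_edges p (SGraph E0); rewrite /= cards0 expr0 => <-.
by apply: eq_bigl => G /=; rewrite finset.sub0set.
Qed.

Definition whp p (A : forall n, pred (sgraph 'I_n)) : Prop :=
  (fun n => gnp_prob p (A n)) @ \oo --> (1 : R).

End RandomGraph.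

(* Main.v *)
Require Import Defs.
From mathcomp Require Import all_boot all_order all_algebra.
From mathcomp Require Import all_classical all_reals all_analysis.
From mathcomp Require Import zify lra.

(** The upper bound holds for every graph: fixing a proper coloring with chi(G)
colors, Painter always colors the largest color class inside the marked set M,
which has at least |M| / chi(G) vertices, so every colored vertex pays for at
most chi(G) points ([painter_bound]).

For the lower bound, write k for a bound on the sizes of independent sets.  A
Lister who always marks everything that is left scores n + (n - k) + ..., hence
at least n^2 / (2k) ([lister_bound]).  It remains to see that chi(G) = O(n / k),
with k of order log n, for almost all graphs.  Both facts come from one
quasirandom property, [balanced]: each vertex set S with at least k vertices
spans more than |S|^2 / D edges and more than |S|^2 / D non-edges, where D is a
constant.
- Such an S spans an edge, so independent sets have fewer than k vertices.
- Such an S has a vertex v with at least |S| / D non-neighbors in S.  Choosing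
  v, passing to its non-neighbors and repeating, a set with k * D^j vertices
  yields an independent set of size j ([greedy_independent]).  With D^j about
  the square root of n, j is still of order log n, and removing independent sets
  of size j until few vertices remain colors G with n / j + k * D^j = O(n / log n)
  colors ([chromatic_number_bound], [balanced_bound]).

That G(n,p) is balanced with high probability is a Chernoff bound
([few_pairs_tail]).  The number X of edges (or non-edges) inside S is binomial,
so E[2^-X] is a power of some r < 1 with exponent |S| (|S| - 1) / 2; hence X is
at most |S|^2 / D with probability at most r^(|S|^2 / 8).  As |S| >= k is a large
multiple of log n, this is at most n^(-2|S|), and the sum of n^(-2|S|) over all
nonempty vertex sets S is (1 + n^-2)^n - 1 = O(1/n). *)

Set Implicit Arguments.
Unset Strict Implicit.
Unset Printing Implicit Defensive.

Import Order.TTheory GRing.Theory Num.Theory.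
Import numFieldNormedType.Exports.

Local Open Scope ring_scope.

(** * Strategies for Lister and Painter, and colorings *)

Section Game.
Local Open Scope nat_scope.
Variables (T : finType) (G : sgraph T).
Implicit Types (S U M I : {set T}) (v : T) (k m j : nat).

(** Marking all of U scores u = |U| and leaves at least u - i vertices, for some
i <= k, and u + (u - i)^2 / (2k) >= u^2 / (2k).  The additive 2k rounds the
quotient u^2 / (2k) up. *)
Lemma lister_marks_all k U t :
    (forall I, independent G I -> #|I| <= k) ->
  2 * k * t < #|U| * #|U| + 2 * k -> lister_guarantees G U t.
Proof.
move=> small; have [n] := ubnP t; elim: n t U => // n IH t U tn tU.
have [->|t0] := posnP t; first exact: ListerReached.
have U0 : U != finset.set0.
  by apply: contraTneq tU => ->; rewrite cards0; nia.
have u0 : 0 < #|U| by rewrite card_gt0.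
apply: (ListerMarks (fintype.subxx U) U0) => I IU indI.
have := small _ indI; have := cardsDS IU; have := subset_leq_card IU.
move=> IU' cUI Ik.
apply: IH; first lia.
rewrite cUI.
have [ut|ut] := leqP #|U| t; last by nia.
nia.
Qed.

Lemma lister_bound k :
    (forall I, independent G I -> #|I| <= k) ->
  #|T| * #|T| <= 2 * k * sum_color_cost G.
Proof.
move=> small; rewrite leqNgt; apply/negP => lt.
have [pai _] := sum_color_costP G.
suff /guarantees_le/(_ pai) : lister_guarantees G [set: T]%SET (sum_color_cost G).+1.
  by rewrite ltnn.
by apply: (lister_marks_all small); rewrite cardsT; lia.
Qed.

(** The potential k * |U| pays for the round: the largest class inside M has at
least |M| / k vertices, and coloring it releases k times as many points. *)
Lemma painter_largest_class k (f : T -> 'I_k) U t :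
    (forall x y, adj G x y -> f x != f y) ->
  k * #|U| <= t -> painter_guarantees G U t.
Proof.
move=> fP; have [n] := ubnP #|U|; elim: n t U => // n IH t U Un Ut.
constructor => M MU M0.
have [x xM] := set0Pn _ M0.
pose C i := [set y in M | f y == i]%SET.
have Msum : #|M| = \sum_(i < k) #|C i|.
  rewrite -sum1_card (partition_big f predT) //=; apply: eq_bigr => i _.
  by rewrite -sum1_card; apply: eq_bigl => y; rewrite inE.
(* f x is only the starting point of the search for the largest class. *)
pose i0 := [arg max_(i > f x) #|C i|].
have i0P i : #|C i| <= #|C i0| by rewrite /i0; case: arg_maxnP => // j _; apply.
have Mk : #|M| <= k * #|C i0|.
  rewrite Msum -[k in leqRHS]card_ord -sum_nat_const; exact: leq_sum.
have CM : C i0 \subset M by apply/fintype.subsetP => y; rewrite inE => /andP[].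
have CU := fintype.subset_trans CM MU.
have cUC := cardsDS CU; have := subset_leq_card CU; have := subset_leq_card MU => MU' CU'.
have m0 : 0 < #|M| by rewrite card_gt0.
exists (C i0); split => //.
- apply/forall_inP => y; rewrite inE => /andP[_ /eqP fy].
  apply/forall_inP => z; rewrite inE => /andP[_ /eqP fz].
  by apply/negP => /fP; rewrite fy fz eqxx.
- nia.
- apply: IH; nia.
Qed.

Lemma painter_bound : sum_color_cost G <= chromatic_number G * #|T|.
Proof.
have [_ lis] := sum_color_costP G.
rewrite /chromatic_number; case: ex_minnP => k /existsP[f fP] _.
apply: (guarantees_le lis); apply: (@painter_largest_class k f); last by rewrite cardsT.
by move=> x y xy; have /forallP/(_ y)/implyP := forallP fP x; apply.
Qed.

Lemma colorable_of_fun k (f : T -> nat) :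
    (forall x, f x < k) -> (forall x y, adj G x y -> f x != f y) ->
  colorable G k.
Proof.
move=> fk fP; apply/existsP; exists [ffun x => Ordinal (fk x)].
apply/forallP => x; apply/forallP => y; apply/implyP => /fP.
by rewrite !ffunE.
Qed.

(** Each color class of size j removes j vertices, and the fewer than m vertices
on which this stops get a color each.  The multiplied form of the bound avoids
division. *)
Lemma greedy_coloring m j U :
    0 < j ->
    (forall S, m <= #|S| ->
       exists I, [/\ I \subset S, independent G I & #|I| = j]) ->
  exists k (f : T -> nat), [/\ k * j <= #|U| + m * j,
    forall x, x \in U -> f x < k &
    forall x y, x \in U -> y \in U -> adj G x y -> f x != f y].
Proof.
move=> j0 ind; have [n] := ubnP #|U|; elim: n U => // n IH U Un.
have [mU|Um] := leqP m #|U|; last first.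
  exists #|U|, (fun x => index x (enum U)); split; first nia.
    by move=> x xU; rewrite cardE index_mem mem_enum.
  move=> x y xU yU; apply: contraTneq => xy.
  suff -> : x = y by rewrite adj_irrefl.
  by rewrite -(nth_index x (_ : x \in enum U)) ?mem_enum // xy nth_index ?mem_enum.
have [I [IU indI cI]] := ind U mU.
have cUI := cardsDS IU; have := subset_leq_card IU => IU'.
have [|k [f [kj fk fP]]] := IH (U :\: I); first lia.
exists k.+1, (fun x => if x \in I then k else f x); split.
- lia.
- by move=> x xU; case: ifPn => // xI; rewrite ltnS ltnW // fk // inE xI.
- move=> x y xU yU xy.
  have fx z : z \in U -> z \notin I -> f z < k by move=> zU zI; apply: fk; rewrite inE zI.
  case: ifPn => xI; case: ifPn => yI.
  + by have /forall_inP/(_ y yI) := forall_inP indI x xI; rewrite xy.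
  + by rewrite gtn_eqF // fx.
  + by rewrite ltn_eqF // fx.
  + by apply: fP; rewrite // inE ?xI ?yI.
Qed.

Lemma chromatic_number_bound m j :
    0 < j ->
    (forall S, m <= #|S| ->
       exists I, [/\ I \subset S, independent G I & #|I| = j]) ->
  chromatic_number G * j <= #|T| + m * j.
Proof.
move=> j0 ind; have [k [f [kj fk fP]]] := greedy_coloring [set: T]%SET j0 ind.
rewrite cardsT in kj; apply: leq_trans kj; rewrite leq_mul2r; apply/orP; right.
rewrite /chromatic_number; case: ex_minnP => c _; apply.
by apply: (@colorable_of_fun _ f) => [x|x y]; [apply: fk|apply: fP].
Qed.

Definition nonneighbors S v := [set u in S | (u != v) && ~~ adj G v u]%SET.

(** Each chosen vertex costs a factor D in the size of the set from which the
next one is taken; the hypothesis applies as long as k vertices are left. *)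
Lemma greedy_independent k D j S :
    (forall S, k <= #|S| -> exists2 v, v \in S & #|S| <= D * #|nonneighbors S v|) ->
    0 < D ->
  k * D ^ j <= #|S| ->
  exists I, [/\ I \subset S, independent G I & #|I| = j].
Proof.
move=> nonnb D0; elim: j S => [|j IH] S kS.
  exists finset.set0; rewrite cards0 finset.sub0set; split => //.
  by apply/forall_inP => x; rewrite inE.
have Dj : 0 < D ^ j by rewrite expn_gt0 D0.
rewrite expnS in kS.
have [|v vS Sv] := nonnb S.
  by apply: leq_trans kS; rewrite leq_pmulr // muln_gt0 D0.
have [|I [IN indI cI]] := IH (nonneighbors S v).
  by rewrite -(leq_pmul2l D0); apply: leq_trans Sv; lia.
have inN u : u \in I -> [/\ u \in S, u != v & ~~ adj G v u].
  by move=> /(fintype.subsetP IN); rewrite inE => /and3P[].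
exists (v |: I)%SET; split.
- apply/fintype.subsetP => u; rewrite !inE => /orP[/eqP->//|/inN[]//].
- apply/forall_inP => x; rewrite !inE => /orP[/eqP->|xI];
  apply/forall_inP => y; rewrite !inE => /orP[/eqP->|yI].
  + by rewrite adj_irrefl.
  + by have [] := inN y yI.
  + by rewrite adj_sym; have [] := inN x xI.
  + by have /forall_inP := forall_inP indI x xI; apply.
- rewrite cardsU1 cI; suff -> : v \notin I by [].
  by apply/negP => /inN[_]; rewrite eqxx.
Qed.

(** Complementation exchanges edges and non-edges and replaces p by 1 - p; the
parameter b lets one tail bound serve both. *)
Definition pairs_with S (b : bool) : {set {set T}} :=
  [set e : {set T} | [&& #|e| == 2, e \subset S & (e \in edges G) == b]]%SET.

(** Each non-edge inside S is obtained from either of its ends; an upper bound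
that counts it twice is good enough. *)
Lemma few_pairs_nonneighbors S :
  #|pairs_with S false| <= \sum_(v in S) #|nonneighbors S v|.
Proof.
pose F v := [set [set v; u]%SET | u in nonneighbors S v]%SET.
have sub : pairs_with S false \subset (\bigcup_(v in S) F v)%SET.
  apply/fintype.subsetP => e; rewrite inE => /and3P[/cards2P[x [y [xy ->]]]].
  move=> /fintype.subsetP xyS nadj.
  have xS : x \in S by apply: xyS; rewrite !inE eqxx.
  have yS : y \in S by apply: xyS; rewrite !inE eqxx orbT.
  apply/finset.bigcupP; exists x => //; apply/imsetP; exists y => //.
  by rewrite inE yS eq_sym xy /adj (eqP nadj).
apply: (leq_trans (subset_leq_card sub)).
apply: (@leq_trans (\sum_(v in S) #|F v|)).
  elim/big_ind2: _ => [|A a B b Aa Bb|//]; first by rewrite cards0.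
  apply: leq_trans (leq_add Aa Bb); exact: leq_card_setU.
by apply: leq_sum => v _; exact: leq_imset_card.
Qed.

Lemma nonneighbors_large D S :
    #|S| * #|S| < D * #|pairs_with S false| ->
  exists2 v, v \in S & #|S| <= D * #|nonneighbors S v|.
Proof.
move=> lt; apply/exists_inP; apply: contraLR lt => /exists_inPn small.
rewrite -leqNgt; apply: (@leq_trans (D * \sum_(v in S) #|nonneighbors S v|)).
  by rewrite leq_mul2l few_pairs_nonneighbors orbT.
rewrite big_distrr /= -sum_nat_const.
by apply: leq_sum => v /small; rewrite -ltnNge => /ltnW.
Qed.

Lemma not_independent S :
  0 < #|pairs_with S true| -> ~~ independent G S.
Proof.
rewrite card_gt0 => /set0Pn[e]; rewrite inE => /and3P[/cards2P[x [y [xy ->]]]].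
move=> /fintype.subsetP xyS /eqP xyG; apply/negP => /forall_inP/(_ x).
rewrite xyS ?inE ?eqxx // => /(_ isT) /forall_inP/(_ y).
by rewrite xyS ?inE ?eqxx ?orbT // /adj xyG => /(_ isT).
Qed.

Definition balanced D k : bool :=
  [forall b : bool, forall S : {set T}, (k <= #|S|) ==>
     (#|S| * #|S| < D * #|pairs_with S b|)].

End Game.

(** * The ratio of the two bounds in a balanced graph *)

Section Deterministic.
Local Open Scope nat_scope.

Lemma sqr_le_exp2_half L : L.+1 * L.+1 <= 12 * 2 ^ L./2.
Proof.
have h2 h : h.+1 * h.+1 <= 3 * 2 ^ h.
  elim: h => // -[//|[//|h]] IH; rewrite expnS; nia.
have := odd_double_half L; have := h2 L./2; case: (odd L); nia.
Qed.

(** The length L = log2 n is the scale: independent sets have size at most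
k = K (L + 1), and j = L / (2a) makes (2^a)^j at most the square root of n.  So
j and k differ by a constant factor only, while the k * (2^a)^j * j vertices
left over by the greedy coloring amount to O(n). *)
Lemma balanced_bound (n K a : nat) (G : sgraph 'I_n) :
    0 < a -> 0 < K -> a.*2 <= trunc_log 2 n ->
    balanced G (2 ^ a) (K * (trunc_log 2 n).+1) ->
  chromatic_number G * n <= 8 * a * K * (1 + 12 * K) * sum_color_cost G.
Proof.
set L := trunc_log 2 n; set k := K * L.+1 => a0 K0 aL /forallP bal.
have n0 : 0 < n by rewrite /L in aL; case: (n) aL => //; rewrite trunc_log0; lia.
have Ln : 2 ^ L <= n by exact: trunc_logP.
have nonnb (S : {set 'I_n}) : k <= #|S| -> exists2 v, v \in S & #|S| <= 2 ^ a * #|nonneighbors G S v|.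
  by move=> kS; apply: nonneighbors_large; have /forallP/(_ S)/implyP := bal false; apply.
have small (I : {set 'I_n}) : independent G I -> #|I| <= k.
  apply: contraLR; rewrite -ltnNge => /ltnW kI; apply: not_independent.
  have /forallP/(_ I)/implyP/(_ kI) := bal true; case: #|pairs_with _ _ _| => //; lia.
pose j := L %/ a.*2.
have j0 : 0 < j by rewrite divn_gt0 //; lia.
have Lj : L.+1 <= 4 * a * j.
  have := ltn_ceil L (_ : 0 < a.*2); rewrite -/j => /(_ _); nia.
have ajL : a * j <= L./2.
  rewrite -divn2; have := leq_divM L a.*2; rewrite -/j; lia.
have D0 : 0 < 2 ^ a by rewrite expn_gt0.
have chi := @chromatic_number_bound _ G (k * (2 ^ a) ^ j) j j0
  (fun S => greedy_independent nonnb D0).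
have lis := lister_bound small.
rewrite card_ord in chi lis.
have mj : k * (2 ^ a) ^ j * j <= 12 * K * n.
  have jL : j <= L.+1 by rewrite ltnW // ltnS leq_div.
  have e1 : (2 ^ a) ^ j <= 2 ^ L./2 by rewrite -expnM leq_exp2l.
  have e2 : 2 ^ L./2 * 2 ^ L./2 <= n.
    by apply: leq_trans Ln; rewrite -expnD leq_exp2l // addnn; lia.
  have e3 := sqr_le_exp2_half L.
  apply: (@leq_trans (K * (L.+1 * L.+1) * 2 ^ L./2)).
    rewrite /k; have -> : K * L.+1 * (2 ^ a) ^ j * j = K * (L.+1 * j) * (2 ^ a) ^ j by lia.
    by rewrite leq_mul // leq_mul // leq_mul.
  apply: (@leq_trans (K * (12 * 2 ^ L./2) * 2 ^ L./2)).
    by rewrite leq_mul // leq_mul.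
  by rewrite (_ : _ * 2 ^ _ = 12 * K * (2 ^ L./2 * 2 ^ L./2)) ?leq_mul //; lia.
have kj : k <= 4 * a * K * j by rewrite /k; nia.
have chi2 : chromatic_number G * j <= (1 + 12 * K) * n by lia.
rewrite -(leq_pmul2r n0).
apply: (@leq_trans (chromatic_number G * (2 * k * sum_color_cost G))).
  by rewrite -mulnA leq_mul.
apply: (@leq_trans (chromatic_number G * (8 * a * K * j * sum_color_cost G))).
  by rewrite leq_mul // leq_mul //; lia.
rewrite (_ : _ * (_ * _) = chromatic_number G * j * (8 * a * K * sum_color_cost G)); last by lia.
apply: leq_trans (leq_mul chi2 (leqnn _)) _; lia.
Qed.

End Deterministic.

(** * Balancedness of the random graph *)

Section Probability.
Variables (R : realType) (p : R) (n : nat).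
Hypothesis hp : 0 < p < 1.
Implicit Types (G : sgraph 'I_n) (S e : {set 'I_n}) (b : bool).

Let p_gt0 : 0 < p. Proof. by case/andP: hp. Qed.
Let p_lt1 : p < 1. Proof. by case/andP: hp. Qed.

Lemma gnp_weight_ge0 G : 0 <= gnp_weight p G.
Proof. by apply: prodr_ge0 => e _; case: ifP => _; have := p_gt0; have := p_lt1; lra. Qed.

Lemma gnp_prob_le (A B : pred (sgraph 'I_n)) :
  (forall G, A G -> B G) -> gnp_prob p A <= gnp_prob p B.
Proof.
move=> AB; rewrite /gnp_prob [leLHS]big_mkcond [leRHS]big_mkcond /=.
apply: ler_sum => G _; case: ifP => [/AB ->//|_]; case: ifP => // _.
exact: gnp_weight_ge0.
Qed.

Lemma gnp_probC (A : pred (sgraph 'I_n)) :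
  gnp_prob p A = 1 - gnp_prob p (fun G => ~~ A G).
Proof.
apply/eqP; rewrite eq_sym subr_eq eq_sym -(gnp_prob_total p n) /gnp_prob [X in _ == X](bigID A) /=.
by [].
Qed.

Lemma gnp_prob_union (I : finType) (P : pred I) (A : I -> pred (sgraph 'I_n)) :
  gnp_prob p (fun G => [exists (i | P i), A i G]) <= \sum_(i | P i) gnp_prob p (A i).
Proof.
under [leRHS]eq_bigr do rewrite /gnp_prob big_mkcond /=.
rewrite exchange_big /= /gnp_prob big_mkcond /=; apply: ler_sum => G _.
have ge0 i : 0 <= (if A i G then gnp_weight p G else 0).
  by case: ifP => // _; exact: gnp_weight_ge0.
case: ifPn => [/existsP[i /andP[Pi Ai]]|_]; last by apply: sumr_ge0 => i _.
by rewrite (bigD1 i) //= Ai lerDl; apply: sumr_ge0 => j _.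
Qed.

(** Distinct pairs are independent, so the mean of a product over pairs is the
product of the means: expanding the product on the right gives one term for
each choice of the set of edges. *)
Lemma gnp_mean_prod (F : {set 'I_n} -> bool -> R) :
  \sum_G gnp_weight p G * \prod_(e : {set 'I_n} | #|e| == 2%N) F e (e \in edges G) =
  \prod_(e : {set 'I_n} | #|e| == 2%N) (p * F e true + (1 - p) * F e false).
Proof.
pose A e := if #|e| == 2%N then p * F e true else 0.
pose B e := if #|e| == 2%N then (1 - p) * F e false else 1.
transitivity (\prod_e (A e + B e)); last first.
  rewrite [RHS]big_mkcond; apply: eq_bigr => e _; rewrite /A /B.
  by case: ifP; rewrite ?add0r.
rewrite bigA_distr (bigID (fun E : {set {set 'I_n}} => [forall e in E, #|e| == 2%N])) /=.
rewrite [X in _ = _ + X]big1 ?addr0; last first.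
  by move=> E /forall_inPn[e eE e2]; rewrite (bigD1 e) //= eE /A (negbTE e2) mul0r.
rewrite (reindex_omap (@edges 'I_n) insub) => [|E E2]; last by rewrite insubT.
apply: eq_big => [G|G _]; first by rewrite edges_card2 (valK G) eqxx.
rewrite /gnp_weight -big_split big_mkcond /=; apply: eq_bigr => e _; rewrite /A /B.
have /forall_inP G2 := edges_card2 G.
case: ifPn => [e2|e2]; first by case: ifP.
by rewrite ifF //; apply: contraNF e2 => /G2.
Qed.

Lemma card_pairs S : #|[set e : {set 'I_n} | (#|e| == 2%N) && (e \subset S)]%SET| = 'C(#|S|, 2).
Proof. by rewrite -cards_draws; apply: eq_card => e; rewrite !inE andbC. Qed.

(** The moment generating function, at 1/2, of the binomial number of pairs
inside S. *)
Lemma mean_half_pow S b :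
  \sum_G gnp_weight p G * 2^-1 ^+ #|pairs_with G S b| =
  (1 - (if b then p else 1 - p) / 2) ^+ 'C(#|S|, 2).
Proof.
pose F e c : R := if (e \subset S) && (c == b) then 2^-1 else 1.
transitivity (\sum_G gnp_weight p G * \prod_(e : {set 'I_n} | #|e| == 2%N) F e (e \in edges G)).
  apply: eq_bigr => G _; congr (_ * _).
  rewrite -prodr_const -big_mkcondr /=; apply: eq_bigl => e.
  by rewrite inE.
rewrite gnp_mean_prod -card_pairs -prodr_const.
under [RHS]eq_bigl do rewrite inE.
rewrite big_mkcondr; apply: eq_bigr => e _; rewrite /F.
by case: (e \subset S); case: (b) => /=; lra.
Qed.

(** Markov's inequality for 2^-X, where X counts the pairs.  As 2^-1 >= r^d and
X <= s^2 / (8d) on the event, 2^-X >= r^(s^2/8) there, while E[2^-X] is at most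
r^(s(s-1)/2), and s(s-1)/2 >= s^2/4; one half of this exponent is lost. *)
Lemma few_pairs_tail r d D y S b :
    0 < r <= 1 -> 1 - (if b then p else 1 - p) / 2 <= r -> r ^+ d <= 2^-1 ->
    (8 * d <= D)%N -> (2 <= #|S|)%N -> (8 * y <= #|S| * #|S|)%N ->
  gnp_prob p (fun G => D * #|pairs_with G S b| <= #|S| * #|S|)%N <= r ^+ y.
Proof.
move=> /andP[r0 r1] br rd dD S2 yS; set s := #|S| in S2 yS *.
pose M := (s * s %/ 8)%N.
have MN : (y + M <= 'C(s, 2))%N.
  (* s * (s - 1) is even, so halving it in 'C(s, 2) loses nothing. *)
  rewrite bin2 /M; have := odd_double_half (s * s.-1); have : ~~ odd (s * s.-1).
    by rewrite oddM; case: (s) S2 => //= m _; case: odd.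
  move=> /negbTE -> /=; have := leq_divM (s * s) 8; nia.
rewrite -(ler_pM2r (exprn_gt0 M r0)) -exprD.
apply: (@le_trans _ _ (r ^+ 'C(s, 2))); last by apply: ler_wiXn2l => //; lra.
apply: (@le_trans _ _ (\sum_G gnp_weight p G * 2^-1 ^+ #|pairs_with G S b|)); last first.
  rewrite mean_half_pow lerXn2r // nnegrE; last lra.
  by have := p_gt0; have := p_lt1; case: b {br}; lra.
rewrite /gnp_prob mulr_suml big_mkcond /=; apply: ler_sum => G _.
have w0 := gnp_weight_ge0 G.
case: ifPn => [X|_]; last by rewrite mulr_ge0 // exprn_ge0.
rewrite ler_wpM2l //; set x := #|_| in X *.
apply: (@le_trans _ _ ((r ^+ d) ^+ x)); last by rewrite lerXn2r // nnegrE ?exprn_ge0 //; lra.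
rewrite -exprM; apply: ler_wiXn2l => //; first lra.
by rewrite /M leq_divRL //; nia.
Qed.

(** Over all S the sum is (1 + x)^n, and the empty set accounts for the 1.  The
rest is at most 2nx as soon as 2nx <= 1, by induction on the exponent. *)
Lemma sum_expr_card_ge (x : R) k :
  0 <= x -> (0 < k)%N -> x * n%:R *+ 2 <= 1 ->
  \sum_(S : {set 'I_n} | (k <= #|S|)%N) x ^+ #|S| <= x * n%:R *+ 2.
Proof.
move=> x0 k0 xn.
apply: (@le_trans _ _ ((x + 1) ^+ n - 1)); last first.
  suff H m : (m <= n)%N -> (x + 1) ^+ m <= 1 + x * m%:R *+ 2 by have := H n (leqnn _); lra.
  elim: m => [|m IH] mn; first by rewrite expr0; lra.
  rewrite exprS; apply: (@le_trans _ _ ((x + 1) * (1 + x * m%:R *+ 2))).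
    by rewrite ler_wpM2l ?IH ?(ltnW mn) //; lra.
  have : x * m%:R *+ 2 <= 1.
    by apply: le_trans xn; rewrite ler_wMn2r // ler_wpM2l // ler_nat ltnW.
  rewrite -natr1; nra.
have -> : (x + 1) ^+ n = \sum_(S : {set 'I_n}) x ^+ #|S|.
  rewrite -[in LHS](card_ord n) -prodr_const bigA_distr; apply: eq_bigr => S _.
  by rewrite -big_mkcond prodr_const.
rewrite [in leRHS](bigD1 finset.set0) //= cards0 expr0 addrAC subrr add0r.
rewrite [leLHS]big_mkcond [leRHS]big_mkcond /=; apply: ler_sum => S _.
case: ifP => kS; last by case: ifP => // _; exact: exprn_ge0.
by rewrite -card_gt0 (leq_trans k0 kS).
Qed.

(** With k of order log n, a set S of size s >= k spans too few edges or
non-edges with probability at most r^(s^2/8) <= r^(2 d (L+1) s) <= 4^(-(L+1)s),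
which is below x^s for x = n^-2; a union bound over b and S then costs 4 / n. *)
Lemma balanced_prob r d D k :
    0 < r <= 1 -> 1 - p / 2 <= r -> 1 - (1 - p) / 2 <= r ->
    r ^+ d <= 2^-1 -> (8 * d <= D)%N -> (2 <= n)%N ->
    (16 * d * (trunc_log 2 n).+1 <= k)%N ->
  1 - 4 / n%:R <= gnp_prob p (fun G => balanced G D k).
Proof.
move=> r01 pr qr rd dD n2 Lk; rewrite gnp_probC lerD2l lerN2.
have [r0 r1] := andP r01.
have d0 : (0 < d)%N by rewrite lt0n; apply: contraTneq rd => ->; rewrite expr0; lra.
set L := trunc_log 2 n in Lk.
have nL : (n < 2 ^ L.+1)%N by apply: trunc_log_ltn.
have n0 : 0 < n%:R :> R by rewrite ltr0n; lia.
pose x : R := (n%:R ^+ 2)^-1.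
have x0 : 0 <= x by rewrite invr_ge0 exprn_ge0 // ltW.
have xn : x * n%:R = n%:R^-1 by rewrite /x expr2 invfM mulfVK // gt_eqF.
have bad b S : (k <= #|S|)%N ->
    gnp_prob p (fun G => D * #|pairs_with G S b| <= #|S| * #|S|)%N <= x ^+ #|S|.
  move=> kS; apply: (@le_trans _ _ (r ^+ (2 * d * L.+1 * #|S|))).
    apply: (few_pairs_tail (d := d)) => //; [by case: b|nia|nia].
  rewrite exprM lerXn2r // ?nnegrE ?exprn_ge0 ?(ltW r0) //.
  rewrite (_ : (2 * d * L.+1 = d * L.+1 * 2)%N) 2?exprM; last by lia.
  apply: (@le_trans _ _ ((2^-1 ^+ L.+1) ^+ 2)).
    by rewrite !lerXn2r ?nnegrE ?exprn_ge0 ?(ltW r0).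
  rewrite !exprVn lef_pV2 ?posrE ?exprn_gt0 ?ltr0n ?(ltnW n2) //.
  by rewrite lerXn2r ?nnegrE ?exprn_ge0 ?ler0n // -natrX ler_nat ltnW.
apply: (@le_trans _ _ (\sum_(b : bool) \sum_(S : {set 'I_n} | (k <= #|S|)%N) x ^+ #|S|)); last first.
  have := @sum_expr_card_ge x k x0; rewrite xn -[n%:R^-1 *+ 2]mulr_natl ler_pdivrMr //.
  rewrite mul1r ler_nat => /(_ _ n2) sumx.
  rewrite big_bool /= (_ : 4 / n%:R = 2 / n%:R + 2 / n%:R); last by lra.
  by rewrite lerD // sumx //; nia.
rewrite pair_big_dep /=.
apply: le_trans (_ : \sum_(i : bool * {set 'I_n} | (k <= #|i.2|)%N)
  gnp_prob p (fun G => D * #|pairs_with G i.2 i.1| <= #|i.2| * #|i.2|)%N <= _); last first.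
  by apply: ler_sum => -[b S] /= kS; exact: bad.
apply: le_trans (gnp_prob_union _ _); apply: gnp_prob_le => G.
move=> /forallPn[b /forallPn[S]]; rewrite negb_imply -leqNgt => /andP[kS X].
by apply/existsP; exists (b, S); rewrite /= kS.
Qed.

End Probability.

Theorem corollary2p4 (R : realType) (p : R) (hp : 0 < p < 1) :
  exists2 c : R, 0 < c &
    whp p (fun (n : nat) (G : sgraph 'I_n) =>
      c * (chromatic_number G)%:R <= ((sum_color_cost G)%:R / n%:R : R)
        <= (chromatic_number G)%:R).
Proof.
have [p0 p1] := andP hp.
(* The larger of the means of (1/2)^[e is an edge] and (1/2)^[e is not an edge]. *)
pose r := Num.max (1 - p / 2) (1 - (1 - p) / 2).
have r01 : 0 < r < 1 by rewrite lt_max gt_max; lra.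
have [d rd] : exists d, r ^+ d <= 2^-1.
  have /cvgrPdist_le/(_ 2^-1) : (GRing.exp r @ \oo --> (0 : R))%classic.
    by apply: cvg_expr; rewrite ger0_norm; lra.
  rewrite invr_gt0 ltr0n => /(_ isT) [N _ /(_ N (leqnn N))] /=.
  have [/ltW r0 _] := andP r01; rewrite sub0r normrN ger0_norm ?exprn_ge0 // => rN.
  by exists N; exact: rN.
have d0 : (0 < d)%N by rewrite lt0n; apply: contraTneq rd => ->; rewrite expr0; lra.
(* D = 2 ^ a is a power of two above the 8 d needed by the tail bound. *)
pose K := (16 * d)%N; pose a := (8 * d)%N; pose C := (8 * a * K * (1 + 12 * K))%N.
have C0 : 0 < C%:R :> R by rewrite ltr0n /C /K /a; nia.
exists C%:R^-1; first by rewrite invr_gt0.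
have main n : (2 ^ a.*2 <= n)%N -> 1 - 4 / n%:R <= gnp_prob p (fun G : sgraph 'I_n =>
   C%:R^-1 * (chromatic_number G)%:R <= ((sum_color_cost G)%:R / n%:R : R)
        <= (chromatic_number G)%:R).
  move=> an.
  have n1 : (2 <= n)%N.
    by apply: leq_trans an; rewrite (@leq_exp2l 2 1) // /a; lia.
  have n0 : 0 < n%:R :> R by rewrite ltr0n; lia.
  apply: le_trans (_ : gnp_prob p (fun G : sgraph 'I_n =>
     balanced G (2 ^ a) (K * (trunc_log 2 n).+1)) <= _).
    apply: (@balanced_prob _ _ _ hp r d) => //.
    - by have /andP[-> /ltW ->] := r01.
    - by rewrite le_max lexx.
    - by rewrite le_max lexx orbT.
    - by rewrite -/a ltnW // ltn_expl.
  apply: gnp_prob_le => // G bal; apply/andP; split; last first.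
    by rewrite ler_pdivrMr // -natrM ler_nat; have := painter_bound G; rewrite card_ord.
  rewrite mulrC ler_pdivlMr // mulrAC ler_pdivrMr // -!natrM ler_nat [leqRHS]mulnC.
  apply: balanced_bound bal; rewrite ?/a ?/K; [lia|lia|].
  exact: trunc_log_max.
apply/cvgrPdist_le => e e0; near=> n.
have nN : (2 ^ a.*2 <= n)%N by near: n; exact: nbhs_infty_ge.
have ne : 4 / e <= n%:R by near: n; exact: nbhs_infty_ger.
set P := gnp_prob p _.
have P1 : P <= 1 by rewrite -(gnp_prob_total p n); exact: gnp_prob_le.
have := main n nN; rewrite -/P => P0.
rewrite ger0_norm ?subr_ge0 //.
have n0 : 0 < n%:R :> R by apply: lt_le_trans ne; rewrite divr_gt0.
have : 4 / n%:R <= e by rewrite ler_pdivrMr // mulrC -ler_pdivrMr.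
lra.
Unshelve. all: by end_near.
Qed.
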